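(* For every integer $n\ge 4$, $$\begin{aligned}A095912(n)=\ &2\cdot\sum_{i=n-1}^{n}\ \prod_{j=1}^{n-1}2^{\,d_{i,j}}\cdot(d_{i,j})!\cdot(b_{i,j}-d_{i,j})!\\&+\sum_{i=3}^{n-2}\ \prod_{j=1}^{n-1}2^{\,d_{i,j}+d_{n+1-i,j}}\cdot\bigl(d_{i,j}+d_{n+1-i,j}\bigr)!\cdot\bigl(b_{i,j}+b_{n+1-i,j}-d_{i,j}-d_{n+1-i,j}\bigr)!\ .\end{aligned}$$
   Context: Places $1,\dots,n$ stand in a row; neighbouring places have distance $1$. At any time at which at least one place is occupied, the distance of an empty place $x$ is $\min|x-y|$ over all occupied places $y$. A run (Teilreihe) is a row of neighbouring empty places; its length is the number of its empty places. Persons arrive one after another and each occupies one empty place. Basic politeness rule: each arriving person (the first chooses freely unless stated otherwise) chooses one of the places so that the distance to an occupied place is maximal. Modified politeness rule: each arriving person (the first chooses freely) chooses one of the places so that the distance to an occupied place is maximal; in doing so, the person shall always occupy one of the places in the runs of greatest length. $A095912(n)$ (the $n$-th term of the OEIS sequence A095912) is the number of ways in which $n$ persons can successively fill the $n$ places obeying the modified politeness rule together with the following additional rule, which concerns only the occupation of places of distance $1$: when the maximal distance is $1$ and no two neighbouring empty places of distance $1$ remain, an end place (place $1$ or place $n$) that is still empty must be occupied before the other remaining places of distance $1$. For positive integers $p,k$, consider $p$ places filled by $p$ persons according to the basic politeness rule with the first person taking the leftmost place. $b_{p,k}$ is the number of persons who occupy a place of distance $k$ (distance taken at the moment of choosing;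 the first person is not counted). $d_{p,k}$ (also for $k=1$) is the number of different sets of two neighbouring places for which, at some time during the filling, both places have distance $k$. Empty sums equal $0$.
   Formalization: The runs of greatest length in the modified rule are taken among rows of neighbouring places of maximal distance, not among all rows of empty places; with the latter the formula fails (n=7: 92 fillings versus 104), as an end run can tie in distance with a longer inner run. *)

(* Defs.v *)
From mathcomp Require Import all_boot.

Set Implicit Arguments.
Unset Strict Implicit.
Unset Printing Implicit Defensive.

(* Place number x (1 <= x <= n) is the element of 'I_n with value x - 1.      *)
Section Seats.

Variable n : nat.
Implicit Types (O E R : {set 'I_n}) (x y : 'I_n) (s : n.-tuple 'I_n).

Definition gap x y : nat := (x - y) + (y - x).

Definition neighbours x y : bool := gap x y == 1.

(* The set of occupied places is O.  The index n of the minimum exceeds every *)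
(* gap, so it is irrelevant as soon as O is nonempty.                         *)
Definition dist O x : nat := \big[minn/n]_(y in O) gap x y.

Definition maxdist O : nat := \max_(x in ~: O) dist O x.

Definition farthest O : {set 'I_n} := [set x in ~: O | dist O x == maxdist O].

Definition polite O x : bool :=
  (x \notin O) && ((O != set0) ==> (x \in farthest O)).

(* A run within E is a nonempty row of neighbouring places of E; it need not  *)
(* be maximal, but a longest one is.                                          *)
Definition is_run E R : bool :=
  [&& R != set0, R \subset E
    & [exists a : 'I_n, exists b : 'I_n, R == [set x : 'I_n | a <= x <= b]]].

Definition in_longest_run E x : bool :=
  [exists R : {set 'I_n},
     [&& is_run E R, x \in R
       & [forall R' : {set 'I_n}, is_run E R' ==> (#|R'| <= #|R|)]]].

(* The runs compared are the runs of (empty) places among which the polite    *)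
(* person may choose, i.e. those formed by places of maximal distance: two    *)
(* neighbouring places of maximal distance precede an isolated one.           *)
Definition modified_polite O x : bool :=
  polite O x && ((O != set0) ==> in_longest_run (farthest O) x).

Definition end_place x : bool := (x == 0 :> nat) || (x.+1 == n).

Definition only_singles O : bool :=
  (maxdist O == 1) &&
  ~~ [exists x : 'I_n, exists y : 'I_n,
        [&& x \notin O, y \notin O, neighbours x y,
            dist O x == 1 & dist O y == 1]].

Definition ends_first O x : bool :=
  [&& O != set0, only_singles O & [exists e in ~: O, end_place e]]
    ==> end_place x.

(* In a filling s the person number t (counted from 0) takes place tnth s t.  *)
Definition occupied (t : nat) s : {set 'I_n} := [set x in take t s].

Definition obeys (rule : {set 'I_n} -> 'I_n -> bool) s : bool :=
  [forall t : 'I_n, rule (occupied t s) (tnth s t)].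

Definition modified_filling s : bool :=
  obeys (fun O x => modified_polite O x && ends_first O x) s.

Definition leftmost_filling s : bool :=
  obeys polite s && [forall t : 'I_n, (t == 0 :> nat) ==> (tnth s t == 0 :> nat)].

Definition nb_at_dist s (k : nat) : nat :=
  #|[set t : 'I_n | (0 < t) && (dist (occupied t s) (tnth s t) == k)]|.

Definition nb_pairs_at_dist s (k : nat) : nat :=
  #|[set P : {set 'I_n} |
      [exists x : 'I_n, exists y : 'I_n,
         [&& P == [set x; y], neighbours x y
           & [exists t : 'I_n,
                [&& 0 < t, x \notin occupied t s, y \notin occupied t s,
                    dist (occupied t s) x == k
                  & dist (occupied t s) y == k]]]]]|.

End Seats.

Definition A095912 (n : nat) : nat :=
  #|[set s : n.-tuple 'I_n | modified_filling s]|.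

(* The numbers b_{p,k} and d_{p,k}, read off from one chosen filling F p of   *)
(* each number p of places.                                                   *)
Definition b_of (F : forall p, p.-tuple 'I_p) (p k : nat) : nat :=
  nb_at_dist (F p) k.

Definition d_of (F : forall p, p.-tuple 'I_p) (p k : nat) : nat :=
  nb_pairs_at_dist (F p) k.

(* Such families F exist; that the numbers do not depend on the choice of F   *)
(* is part of any result stated for all F.                                    *)
Lemma leftmost_filling_exists (p : nat) :
  0 < p -> exists s : p.-tuple 'I_p, leftmost_filling s.
Proof.
case: p => // p _.
have polite_ex (O : {set 'I_p.+1}) : #|O| < p.+1 -> exists x, polite O x.
  move=> ltO; have gt0 : 0 < #|~: O| by rewrite cardsCs setCK card_ord subn_gt0.
  have [x xO maxx] := eq_bigmax_cond (dist O) gt0.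
  exists x; rewrite /polite -in_setC xO inE xO /maxdist maxx eqxx.
  exact: implybT.
have [s [size_s s0 politeP]] : exists s : seq 'I_p.+1,
    [/\ size s = p.+1, nth ord0 s 0 = ord0
      & forall t, t < p.+1 -> polite [set x in take t s] (nth ord0 s t)].
  suff : forall m, m <= p -> exists s : seq 'I_p.+1,
      [/\ size s = m.+1, nth ord0 s 0 = ord0
        & forall t, t < m.+1 -> polite [set x in take t s] (nth ord0 s t)].
    exact.
  elim=> [_|m IHm lt_mp].
    exists [:: ord0]; split=> // -[|//] _.
    have -> : [set x in take 0 [:: ord0]] = set0 :> {set 'I_p.+1}.
      by apply/setP => x; rewrite !inE.
    by rewrite /polite inE eqxx.
  have [s [size_s s0 sP]] := IHm (ltnW lt_mp).
  have [|x xP] := polite_ex [set x in s].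
    by rewrite cardsE (leq_ltn_trans (card_size s)) // size_s.
  exists (rcons s x); split; first by rewrite size_rcons size_s.
    by rewrite nth_rcons size_s.
  move=> t; rewrite nth_rcons size_s ltnS leq_eqVlt -cats1 take_cat size_s.
  case/predU1P=> [->|lt_tm]; first by rewrite ltnn eqxx subnn /= cats0.
  by rewrite lt_tm; apply: sP.
have size_sE : size s == p.+1 by rewrite size_s.
exists (Tuple size_sE); apply/andP; split; apply/forallP => t.
  by rewrite (tnth_nth ord0); apply: politeP.
by apply/implyP => /eqP t0; rewrite (tnth_nth ord0) t0 /= s0.
Qed.

(* Main.v *)
Require Import Defs.
From mathcomp Require Import all_boot.
From mathcomp Require Import zify.

(** The occupied places cut the row into slots, and a farthest place is a
    middle of a slot (or an end place): an interior slot of width [w] has maximal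
    distance [w./2] and splits into slots of widths [w./2] and [uphalf w],
    whichever middle is taken.  Hence the numbers of pairs and of single places
    still to be met at each distance [j], say [p_j] and [q_j], are sums of weights
    over the slots; so is the number [m] of empty end places next to an occupied
    place, which are filled between the pairs and the singles of distance 1.  A
    legal choice lowers exactly one of these numbers, by one, so every nonempty
    state has [m! * prod_j 2^p_j * p_j! * q_j!] completions, by induction on the
    number of empty places.  For the first person at place [i] the initial slots
    are two end slots of widths [i] and [n + 1 - i], each as in the filling
    that defines [b] and [d].                                                *)

Set Implicit Arguments.
Unset Strict Implicit.
Unset Printing Implicit Defensive.

(** * Costs accumulated while an interior slot is halved *)

Fixpoint halving_rec (c : nat -> nat) (m w : nat) : nat :=
  if m is m'.+1 then
    if w <= 1 then 0
    else c w + (halving_rec c m' w./2 + halving_rec c m' (uphalf w))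
  else 0.

(* The cost [c] summed over all slots of width at least 2 met while an interior
   slot of width [w], that is [w - 1] empty places between two occupied ones, is
   filled. *)
Definition halving c w := halving_rec c w w.

(** Both halves of a width above 1 are smaller than it, so any fuel that reaches the width is
    enough. *)
Lemma halving_rec_fuel c m m' w :
  w <= m -> w <= m' -> halving_rec c m w = halving_rec c m' w.
Proof.
elim: m m' w => [|m IHm] [|m'] w //=.
- by move=> /[!leqn0]/eqP->.
- by move=> _ /[!leqn0]/eqP->.
move=> le1 le2; case: (leqP w 1) => // lt1w.
by rewrite (IHm m' w./2) 1?(IHm m' (uphalf w)) //; lia.
Qed.

Lemma halving_le1 c w : w <= 1 -> halving c w = 0.
Proof. by case: w => [|[|]]. Qed.

Lemma halvingE c w :
  1 < w -> halving c w = c w + (halving c w./2 + halving c (uphalf w)).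
Proof.
move=> lt1w; rewrite {1}/halving (@halving_rec_fuel c w w.+1) // /=.
rewrite leqNgt lt1w /=; congr (_ + (_ + _)); apply: halving_rec_fuel; lia.
Qed.

Lemma halvingD c1 c2 c w : (forall v, c v = c1 v + c2 v) ->
  halving c w = halving c1 w + halving c2 w.
Proof.
move=> cE; elim/ltn_ind: w => w IHw.
case: (leqP w 1) => [le1|lt1]; first by rewrite !halving_le1.
rewrite (halvingE c lt1) (halvingE c1 lt1) (halvingE c2 lt1) cE.
by rewrite (IHw w./2) ?(IHw (uphalf w)); lia.
Qed.

Lemma halving_eq0 c w : (forall v, v <= w -> c v = 0) -> halving c w = 0.
Proof.
elim/ltn_ind: w => w IHw c0.
case: (leqP w 1) => [le1|lt1]; first by rewrite halving_le1.
rewrite (halvingE c lt1) c0 // (IHw w./2) ?(IHw (uphalf w)) //; try lia.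
  by move=> v lev; apply: c0; lia.
by move=> v lev; apply: c0; lia.
Qed.

(** * Slots between consecutive bounds *)

Definition slot (P : pred nat) l r :=
  [&& P l, P r, l < r & all (predC P) (iota l.+1 (r - l.+1))].

Lemma slotP (P : pred nat) l r :
  reflect [/\ P l, P r, l < r & forall z, l < z < r -> ~~ P z] (slot P l r).
Proof.
apply: (iffP and4P) => -[Pl Pr ltlr allz]; split=> //.
  move=> z ltz; apply: (allP allz); rewrite mem_iota; lia.
by apply/allP => z; rewrite mem_iota => zP; apply: allz; lia.
Qed.

(** If the slots differed, a bound of one would lie strictly inside the other. *)
Lemma slot_uniq (P : pred nat) l r l' r' z :
  slot P l r -> slot P l' r' -> l < z < r -> l' < z < r' -> l = l' /\ r = r'.
Proof.
move=> /slotP[Pl Pr _ nP] /slotP[Pl' Pr' _ nP'] zP zP'.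
have := contraTN (@nP l') Pl'; have := contraTN (@nP r') Pr'.
have := contraTN (@nP' l) Pl; have := contraTN (@nP' r) Pr; lia.
Qed.

Lemma slot_exists (P : pred nat) a b z :
  P a -> P b -> a < z < b -> ~~ P z -> exists l r, slot P l r /\ l < z < r.
Proof.
move=> Pa Pb ltz nPz.
have exl : exists l, P l && (l < z) by exists a; rewrite Pa; lia.
have exr : exists r, P r && (z < r) by exists b; rewrite Pb; lia.
have ubl l : P l && (l < z) -> l <= z by lia.
case: (ex_maxnP exl ubl) => l /andP[Pl ltlz] maxl.
case: (ex_minnP exr) => r /andP[Pr ltzr] minr.
exists l, r; split; last by lia.
apply/slotP; split=> //; first by lia.
move=> y lty; apply/negP => Py.
case: (ltngtP y z) => cyz.
- have := maxl y; rewrite Py cyz => /(_ isT); lia.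
- have := minr y; rewrite Py cyz => /(_ isT); lia.
by rewrite -cyz Py in nPz.
Qed.

(** A new bound matters only to the slot around it, which gives way to its two parts. *)
Lemma slot_insert (P Q : pred nat) x l r a b :
    slot P l r -> l < x < r -> (forall z, Q z = (z == x) || P z) ->
  slot Q a b = [|| (a == l) && (b == x), (a == x) && (b == r)
                 | slot P a b && ~~ ((a == l) && (b == r))].
Proof.
move=> slr ltx QE; have /slotP[Pl Pr ltlr nP] := slr.
have nPx := nP x ltx.
apply/idP/idP.
  move=> /slotP[]; rewrite !QE => Qa Qb ltab nQ.
  case: (eqVneq a x) Qa => [ax|nax] /= Qa.
    suff /eqP -> : b == r by rewrite eqxx orbT.
    have := nQ r; rewrite QE Pr orbT; have := nP b; case: (P b) Qb; lia.
  case: (eqVneq b x) Qb => [bx|nbx] /= Qb.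
    suff /eqP -> : a == l by rewrite eqxx.
    by have := nQ l; rewrite QE Pl orbT; have := nP a; rewrite Qa; lia.
  rewrite andbF /=; apply/andP; split; last first.
    apply/negP => /andP[/eqP al /eqP br]; have := nQ x; rewrite QE eqxx; lia.
  apply/slotP; split=> // z zP; have := nQ z zP; rewrite QE negb_or.
  by case/andP.
case/or3P => [/andP[/eqP-> /eqP->]|/andP[/eqP-> /eqP->]|/andP[sab nab]].
- apply/slotP; rewrite !QE eqxx Pl orbT; split=> //; first lia.
  by move=> z zP; rewrite QE negb_or nP ?andbT; lia.
- apply/slotP; rewrite !QE eqxx Pr orbT; split=> //; first lia.
  by move=> z zP; rewrite QE negb_or nP ?andbT; lia.
have /slotP[Pa Pb ltab nPab] := sab.
apply/slotP; rewrite !QE Pa Pb !orbT; split=> // z zP.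
rewrite QE negb_or nPab // andbT; apply/eqP => zx.
have ltxab : a < x < b by rewrite -zx.
have [al br] := slot_uniq sab slr ltxab ltx; move: nab; lia.
Qed.

(* Place [x] is shifted to [x.+1], so that [0] and [n.+1] are sentinels. *)
Definition bound n (O : {set 'I_n}) : pred nat :=
  fun z => [|| z == 0, z == n.+1 | [exists y in O, z == y.+1]].

Lemma boundS n (O : {set 'I_n}) (x : 'I_n) : bound O x.+1 = (x \in O).
Proof.
rewrite /bound /= eqSS; have /ltn_eqF-> /= := ltn_ord x.
apply/existsP/idP => [[y /andP[yO /eqP[/val_inj->]]] // | xO].
by exists x; rewrite xO eqxx.
Qed.

Lemma bound_max n (O : {set 'I_n}) : bound O n.+1.
Proof. by rewrite /bound eqxx orbT. Qed.

Lemma bound_le n (O : {set 'I_n}) z : bound O z -> z <= n.+1.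
Proof.
case/or3P => [/eqP->|/eqP->|/existsP[y /andP[_ /eqP->]]] //.
by rewrite ltnS ltnW.
Qed.

Lemma bound_place n (O : {set 'I_n}) z :
  bound O z -> z != 0 -> z != n.+1 -> exists2 y : 'I_n, y \in O & z = y.+1.
Proof.
case/or3P => [->|->|/existsP[y /andP[yO /eqP->]]] // _ _.
by exists y.
Qed.

Lemma bound_insert n (O : {set 'I_n}) x z :
  bound (x |: O) z = (z == x.+1) || bound O z.
Proof.
rewrite /bound; case: (z == 0); first by rewrite orbT.
case: (z == n.+1) => /=; first by rewrite orbT.
apply/existsP/orP => [[y /andP[/setU1P[->|yO] zy]]|[zx|/existsP[y /andP[yO zy]]]].
- by left.
- by right; apply/existsP; exists y; rewrite yO.
- by exists x; rewrite setU11.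
- by exists y; rewrite setU1r.
Qed.

(** An occupied place prevents a slot from stretching between both sentinels. Hence the order in
    which later definitions test the two ends is irrelevant. *)
Lemma slot_bounds n (O : {set 'I_n}) l r :
  O != set0 -> slot (bound O) l r ->
  [/\ l < r, r <= n.+1 & ~~ ((l == 0) && (r == n.+1))].
Proof.
case/set0Pn => y yO /slotP[_ /bound_le ler ltlr nb]; split=> //.
apply/negP => /andP[/eqP l0 /eqP rn]; have := nb y.+1.
by rewrite l0 rn boundS yO /= ltnS ltn_ord => /(_ isT).
Qed.

Lemma slot_of n (O : {set 'I_n}) x :
  x \notin O -> exists l r, slot (bound O) l r /\ l < x.+1 < r.
Proof.
rewrite -boundS => nx; apply: (@slot_exists _ 0 n.+1 x.+1) => //.
  exact: bound_max.
by rewrite /= ltnS ltn_ord.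
Qed.

Lemma slot_notin n (O : {set 'I_n}) l r (x : 'I_n) :
  slot (bound O) l r -> l < x.+1 < r -> x \notin O.
Proof. by move=> /slotP[_ _ _ nb] /nb; rewrite boundS. Qed.

(** * Distances inside a slot *)

(** A sentinel is not occupied, so in an end slot only the other bound counts. *)
Definition slot_dist n l r z :=
  if l == 0 then r - z else if r == n.+1 then z - l else minn (z - l) (r - z).

Definition reach n l r :=
  if (l == 0) || (r == n.+1) then (r - l).-1 else (r - l)./2.

(** The places where [reach] is attained: the end place of an end slot, and otherwise one middle or
    two adjacent ones, according to the parity of the width. *)
Definition mid n l r z :=
  if l == 0 then z == 1 else if r == n.+1 then z == n
  else (z == l + (r - l)./2) || (z == l + uphalf (r - l)).

Lemma slot_dist_le n l r z :
  l < z < r -> r <= n.+1 -> ~~ ((l == 0) && (r == n.+1)) ->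
  slot_dist n l r z <= reach n l r.
Proof. rewrite /slot_dist /reach;
  case: (l =P 0) => ?; case: (r =P n.+1) => ? /=; lia. Qed.

Lemma slot_dist_eq n l r z :
  l < z < r -> r <= n.+1 -> ~~ ((l == 0) && (r == n.+1)) ->
  (slot_dist n l r z == reach n l r) = mid n l r z.
Proof. rewrite /slot_dist /reach /mid;
  case: (l =P 0) => ?; case: (r =P n.+1) => ? /=; lia. Qed.

Lemma mid_exists n l r :
  1 < r - l -> r <= n.+1 -> exists z, l < z < r /\ mid n l r z.
Proof.
move=> lt1 lern; rewrite /mid; case: eqP => [->|_]; first by exists 1; lia.
case: eqP => [->|_]; first by exists n; lia.
by exists (l + (r - l)./2); lia.
Qed.

(** The condition [m <= n] takes care of the default value [n] of the minimum. *)
Lemma leq_dist n (O : {set 'I_n}) x m :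
  m <= n -> (m <= dist O x) = [forall (y | y \in O), m <= gap x y].
Proof.
move=> lemn; rewrite /dist -big_andE.
by apply: (big_morph (leq m)) => // a b; rewrite leq_min.
Qed.

(** All occupied places lie outside the slot or on its bounds, so a nearest one is a bound. *)
Lemma dist_slot n (O : {set 'I_n}) (x : 'I_n) l r :
    O != set0 -> slot (bound O) l r -> l < x.+1 < r ->
  dist O x = slot_dist n l r x.+1.
Proof.
move=> O0 slr ltx; have [ltlr lern nlr] := slot_bounds O0 slr.
have /slotP[bl br _ nb] := slr.
have ltxn := ltn_ord x.
apply/eqP; rewrite eqn_leq; apply/andP; split; last first.
  rewrite leq_dist; last by rewrite /slot_dist;
    case: (l =P 0) => ?; case: (r =P n.+1) => ? /=; lia.
  apply/forallP => y; apply/implyP => yO.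
  have := nb y.+1; rewrite boundS yO /= => nby.
  have ny : ~ (l < y.+1 < r) by move/nby.
  have := ltn_ord y; rewrite /slot_dist /gap;
    case: (l =P 0) => ?; case: (r =P n.+1) => ? /=; lia.
have dist_le y : y \in O -> dist O x <= gap x y.
  move=> yO; have le : dist O x <= n.
    rewrite /dist; elim/big_ind: _ => // [a b lea _|z _];
      first by rewrite geq_min lea.
    by have := ltn_ord z; rewrite /gap; lia.
  by have := leqnn (dist O x); rewrite leq_dist // => /forall_inP/(_ y yO).
have le_l : l != 0 -> dist O x <= x.+1 - l.
  move=> l0; have [|y yO ly] := bound_place bl l0; first by lia.
  by have := dist_le y yO; rewrite /gap; lia.
have le_r : r != n.+1 -> dist O x <= r - x.+1.
  move=> rn; have r0 : r != 0 by lia.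
  have [y yO ry] := bound_place br r0 rn.
  by have := dist_le y yO; rewrite /gap; lia.
move: le_l le_r; rewrite /slot_dist;
  case: (l =P 0) => ?; case: (r =P n.+1) => ? /=; lia.
Qed.

Lemma dist_le_maxdist n (O : {set 'I_n}) x : x \notin O -> dist O x <= maxdist O.
Proof. by move=> xO; apply: leq_bigmax_cond; rewrite inE. Qed.

(** A slot of width at least 2 contains a place whose distance is the reach; a slot of width 1 has
    reach 0. *)
Lemma reach_le_maxdist n (O : {set 'I_n}) l r :
  O != set0 -> slot (bound O) l r -> reach n l r <= maxdist O.
Proof.
move=> O0 slr; have [ltlr lern nlr] := slot_bounds O0 slr.
case: (ltnP 1 (r - l)) => [lt1|le1]; last by rewrite /reach; case: ifP; lia.
have [z [ltz mz]] := mid_exists lt1 lern.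
have ltzn : z.-1 < n by lia.
have zE : z = (Ordinal ltzn).+1 by rewrite /=; lia.
move: ltz mz; rewrite zE => ltz; rewrite -slot_dist_eq // => /eqP <-.
by rewrite -(dist_slot O0 slr) // dist_le_maxdist // (slot_notin slr).
Qed.

(** In the chain distance, reach, maximal distance, the outer terms agree exactly when both
    inequalities are equalities. *)
Lemma farthest_slot n (O : {set 'I_n}) (x : 'I_n) l r :
    O != set0 -> slot (bound O) l r -> l < x.+1 < r ->
  (x \in farthest O) = mid n l r x.+1 && (reach n l r == maxdist O).
Proof.
move=> O0 slr ltx; have [ltlr lern nlr] := slot_bounds O0 slr.
have xO := slot_notin slr ltx; have le_max := reach_le_maxdist O0 slr.
have := slot_dist_le ltx lern nlr.
rewrite !inE xO /= -slot_dist_eq // (dist_slot O0 slr ltx); lia.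
Qed.

(** * Weights of slots and their sum *)

(** Total cost of filling a slot. In an end slot the first person takes the end place, which leaves
    an interior slot narrower by one; [ci] and [ce] are the costs of interior and end slots. *)
Definition slot_weight n (ci ce : nat -> nat) l r :=
  if (l == 0) || (r == n.+1) then
    if r - l <= 1 then 0 else ce (r - l) + halving ci (r - l).-1
  else halving ci (r - l).

Definition slot_cost n (ci ce : nat -> nat) l r :=
  if (l == 0) || (r == n.+1) then ce (r - l) else ci (r - l).

Definition slot_sum n (ci ce : nat -> nat) (O : {set 'I_n}) :=
  \sum_(p : 'I_n.+2 * 'I_n.+2 | slot (bound O) p.1 p.2)
     slot_weight n ci ce p.1 p.2.

Lemma slot_weight_mid n ci ce l r z :
    l < z < r -> r <= n.+1 -> ~~ ((l == 0) && (r == n.+1)) -> mid n l r z ->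
  slot_weight n ci ce l r =
    slot_cost n ci ce l r
    + (slot_weight n ci ce l z + slot_weight n ci ce z r).
Proof.
move=> ltz lern nlr; rewrite /mid /slot_weight /slot_cost.
case: eqP nlr => [->|l0] /= nlr.
  move/eqP=> z1; rewrite z1 (negbTE nlr) /= ifF; last by lia.
  by rewrite subn0 subn1.
case: eqP => [->|nr] /=.
  move/eqP=> zn; rewrite zn orbT (ltn_eqF (ltnSn n)) subSnn /= addn0.
  by rewrite ifF; [congr (_ + halving _ _); lia | lia].
have -> : (z == n.+1) = false by lia.
have -> : (z == 0) = false by lia.
rewrite /= halvingE; last by lia.
(* The two middles produce the same two widths in opposite order. *)
case/orP => /eqP ->; congr (_ + _); last rewrite addnC;
  congr (halving _ _ + halving _ _); lia.
Qed.

(** Only the slot around [x] changes, and [slot_weight_mid] balances its weight against those of its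
    two parts. *)
Lemma slot_sum_insert n ci ce (O : {set 'I_n}) (x : 'I_n) l r :
    O != set0 -> slot (bound O) l r -> l < x.+1 < r -> mid n l r x.+1 ->
  slot_sum ci ce O = slot_cost n ci ce l r + slot_sum ci ce (x |: O).
Proof.
move=> O0 slr ltx mx; have [ltlr lern nlr] := slot_bounds O0 slr.
have ltl : l < n.+2 by lia.
have ltr : r < n.+2 by lia.
have ltz : x.+1 < n.+2 by lia.
pose l' := Ordinal ltl; pose r' := Ordinal ltr; pose x' := Ordinal ltz.
have ins a b := slot_insert a b slr ltx (bound_insert O x).
rewrite /slot_sum (bigD1 (l', r')) //= (slot_weight_mid _ _ ltx) //.
rewrite [RHS]addnC [in RHS](bigD1 (l', x')) /=; last by rewrite ins !eqxx.
rewrite [in RHS](bigD1 (x', r')) /=; last first.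
  by rewrite ins !eqxx orbT /= xpair_eqE; apply/negP; rewrite -!val_eqE /=; lia.
rewrite [RHS]addnC -!addnA; do 3!congr (_ + _).
apply: eq_bigl => -[a b] /=; rewrite ins !xpair_eqE -!val_eqE /=.
case sab: (slot _ a b) => /=; last by lia.
have /slotP[ba bb _ _] := sab; have bx := slot_notin slr ltx.
rewrite -boundS in bx.
have nax : (a == x.+1 :> nat) = false by apply/eqP => ax; rewrite -ax ba in bx.
have nbx : (b == x.+1 :> nat) = false by apply/eqP => ax; rewrite -ax bb in bx.
by rewrite nax nbx !andbF /= !andbT.
Qed.

(** * Pairs, singles and empty ends still to be met *)

Definition no_cost (w : nat) := 0.
(** An interior slot of width [2k+1] has two adjacent middles at distance [k], one of width [2k]
    only one. An end slot never offers a pair, hence [no_cost] in [pairs]. *)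
Definition pair_cost (k w : nat) : nat := odd w && (w./2 == k).
Definition single_cost (k w : nat) : nat := ~~ odd w && (w./2 == k).
(* An end slot of width 2 is left out: [near_end_cost] counts it. *)
Definition single_end_cost (k w : nat) : nat := (w.-1 == k) && (w != 2).
Definition near_end_cost (w : nat) : nat := w == 2.

Definition pairs n k (O : {set 'I_n}) := slot_sum (pair_cost k) no_cost O.
Definition singles n k (O : {set 'I_n}) :=
  slot_sum (single_cost k) (single_end_cost k) O.
Definition near_ends n (O : {set 'I_n}) := slot_sum no_cost near_end_cost O.

Definition inner n l r := ~~ ((l == 0) || (r == n.+1)).

Lemma halving_pair_small k w : w <= k.*2 -> halving (pair_cost k) w = 0.
Proof. by move=> le; apply: halving_eq0 => v lev; rewrite /pair_cost; lia. Qed.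

Lemma halving_single_small k w : w < k.*2 -> halving (single_cost k) w = 0.
Proof. by move=> le; apply: halving_eq0 => v lev; rewrite /single_cost; lia. Qed.

(** When the reach is at most [k], all later parts are too narrow to offer a pair at distance [k];
    only the slot itself can count. *)
Lemma pair_weight n k l r : 0 < k -> reach n l r <= k ->
  slot_weight n (pair_cost k) no_cost l r = (inner n l r && (r - l == k.*2.+1)).
Proof.
rewrite /slot_weight /reach /inner => k0; case: ifP => _ /= le.
  by case: ifP => // _; rewrite halving_pair_small //; lia.
case: (leqP (r - l) k.*2) => lt; first by rewrite halving_pair_small //; lia.
rewrite halvingE; last by lia.
by rewrite !halving_pair_small /pair_cost; lia.
Qed.

(** Width [2k+1] is excluded because for [k = 1] it leaves a part of width [2 = 2k], which is a
    single at the same distance. *)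
Lemma single_weight n k l r : 0 < k -> reach n l r <= k ->
    ~~ (inner n l r && (r - l == k.*2.+1)) ->
  slot_weight n (single_cost k) (single_end_cost k) l r =
    if inner n l r then r - l == k.*2 else (r - l == k.+1) && (k != 1).
Proof.
rewrite /slot_weight /reach /inner => k0; case: ifP => _ /= le nd.
  case: ifP => [le1|_]; first by lia.
  by rewrite halving_single_small /single_end_cost; lia.
case: (ltnP (r - l) k.*2) => lt; first by rewrite halving_single_small //; lia.
rewrite halvingE; last by lia.
by rewrite !halving_single_small /single_cost; lia.
Qed.

Lemma near_end_weight n l r :
  slot_weight n no_cost near_end_cost l r = ~~ inner n l r && (r - l == 2).
Proof.
rewrite /slot_weight /inner; have h0 w : halving no_cost w = 0.
  exact: halving_eq0.
by case: ifP => _ /=; rewrite ?h0 //; case: ifP; rewrite /near_end_cost; lia.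
Qed.

(** * Counting empty places slot by slot *)

(** Double counting: each empty place lies inside exactly one slot. *)
Lemma card_by_slot n (O S : {set 'I_n}) : S \subset ~: O ->
  #|S| = \sum_(p : 'I_n.+2 * 'I_n.+2 | slot (bound O) p.1 p.2)
           #|[set x in S | p.1 < x.+1 < p.2]|.
Proof.
move=> /subsetP SO; rewrite -sum1_card.
transitivity (\sum_(x in S) \sum_(p : 'I_n.+2 * 'I_n.+2 |
                 slot (bound O) p.1 p.2) (p.1 < x.+1 < p.2)).
  apply: eq_bigr => x /SO; rewrite inE => xO.
  have [l [r [slr ltx]]] := slot_of xO.
  have /slotP[/bound_le lel /bound_le ler _ _] := slr.
  rewrite (bigD1 (Ordinal (lel : l < n.+2), Ordinal (ler : r < n.+2))) //=.
  rewrite ltx big1 // => -[a b] /= /andP[sab nab].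
  apply/eqP; rewrite eqb0; apply: contra nab => ltab.
  have [al br] := slot_uniq sab slr ltab ltx.
  by apply/eqP; congr (_, _); apply: val_inj.
rewrite exchange_big; apply: eq_bigr => p _.
by rewrite -big_mkcondr sum1dep_card.
Qed.

Lemma slot_sum_card n ci ce c (O S : {set 'I_n}) : S \subset ~: O ->
    (forall l r, slot (bound O) l r ->
       #|[set x in S | l < x.+1 < r]| = c * slot_weight n ci ce l r) ->
  #|S| = c * slot_sum ci ce O.
Proof.
move=> SO cP; rewrite (card_by_slot SO) /slot_sum big_distrr /=.
by apply: eq_bigr => p; apply: cP.
Qed.

Lemma slot_sum_eq0 n ci ce (O : {set 'I_n}) l r :
  slot_sum ci ce O = 0 -> slot (bound O) l r -> slot_weight n ci ce l r = 0.
Proof.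
move=> /eqP; rewrite sum_nat_eq0 => /forallP allp slr.
have /slotP[/bound_le lel /bound_le ler _ _] := slr.
have /implyP := allp (Ordinal (lel : l < n.+2), Ordinal (ler : r < n.+2)).
by move=> /(_ slr)/eqP.
Qed.

Lemma card_place1 n (P : pred 'I_n) v : 0 < v <= n ->
  (forall x, P x = (x.+1 == v)) -> #|[set x | P x]| = 1.
Proof.
move=> ltv PE; have ltvn : v.-1 < n by lia.
rewrite (_ : [set x | P x] = [set Ordinal ltvn]) ?cards1 //.
by apply/setP => x; rewrite !inE PE -val_eqE /=; lia.
Qed.

Lemma card_place2 n (P : pred 'I_n) v : 0 < v < n ->
  (forall x, P x = (x.+1 == v) || (x.+1 == v.+1)) -> #|[set x | P x]| = 2.
Proof.
move=> ltv PE; have ltvn : v.-1 < n by lia.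
have ltvn' : v < n by lia.
rewrite (_ : [set x | P x] = [set Ordinal ltvn; Ordinal ltvn']).
  by rewrite cards2 -val_eqE /=; lia.
by apply/setP => x; rewrite !inE PE -!val_eqE /=; lia.
Qed.

(** * Neighbouring places at equal distance *)

Definition twins n (O : {set 'I_n}) k x y :=
  [&& x \notin O, y \notin O, neighbours x y, dist O x == k & dist O y == k].

Lemma twinsC n (O : {set 'I_n}) k x y : twins O k x y = twins O k y x.
Proof.
rewrite /twins /neighbours /gap addnC.
by case: (x \in O); case: (y \in O) => //=; case: eqP => //= _; rewrite andbC.
Qed.

Lemma slot_neighbour n (O : {set 'I_n}) l r (x y : 'I_n) :
    slot (bound O) l r -> l < x.+1 < r -> y \notin O -> neighbours x y ->
  l < y.+1 < r.
Proof.
move=> /slotP[bl br _ _] ltx; rewrite -boundS /neighbours /gap => ny.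
have nl : l != y.+1 by apply: contraNneq ny => <-.
have nr : r != y.+1 by apply: contraNneq ny => <-.
by lia.
Qed.

(** Along an end slot the distance is strictly monotone; in an interior slot neighbours have equal
    distance only across the centre of an odd width. *)
Lemma twins_slot n (O : {set 'I_n}) k l r (x y : 'I_n) :
    O != set0 -> slot (bound O) l r -> l < x.+1 < r -> y = x.+1 :> nat ->
  twins O k x y =
    [&& inner n l r, r - l == k.*2.+1, 0 < k & x.+1 == l + k].
Proof.
move=> O0 slr ltx yx; have [ltlr lern nlr] := slot_bounds O0 slr.
have nxy : neighbours x y by rewrite /neighbours /gap; lia.
have xO := slot_notin slr ltx.
rewrite /twins xO nxy /=; case yO: (y \in O) => /=.
  have : r <= y.+1.
    rewrite leqNgt; apply/negP => lty.
    by have := slot_notin slr (_ : l < y.+1 < r); rewrite yO => /(_ ltac:(lia)).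
  by move=> ?; lia.
have lty := slot_neighbour slr ltx (negbT yO) nxy.
rewrite (dist_slot O0 slr ltx) (dist_slot O0 slr lty) /slot_dist /inner yx.
by move: nlr; case: (l =P 0) => ?; case: (r =P n.+1) => ? /=; lia.
Qed.

Lemma twinsP n (O : {set 'I_n}) k l r (x : 'I_n) :
    O != set0 -> slot (bound O) l r -> l < x.+1 < r ->
  [exists y, twins O k x y] =
    [&& inner n l r, r - l == k.*2.+1, 0 < k & mid n l r x.+1].
Proof.
move=> O0 slr ltx; have [ltlr lern nlr] := slot_bounds O0 slr.
apply/existsP/idP => [[y tw]|].
  have /and5P[xO yO nxy _ _] := tw.
  have lty := slot_neighbour slr ltx yO nxy.
  have [yx|xy] : y = x.+1 :> nat \/ x = y.+1 :> nat.
    by move: nxy; rewrite /neighbours /gap; lia.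
  - by move: tw; rewrite (twins_slot k O0 slr ltx yx) /mid /inner;
    case: (l =P 0) => ?; case: (r =P n.+1) => ? /=; lia.
  by move: tw; rewrite twinsC (twins_slot k O0 slr lty xy) /mid /inner;
    case: (l =P 0) => ?; case: (r =P n.+1) => ? /=; lia.
move=> /and4P[inn rl k0 mx].
(* The middles are [l + k] and [l + k.+1]; the partner of [x] is the other one. *)
have [xl|xl] : x.+1 = l + k \/ x.+1 = l + k.+1.
- by move: inn mx; rewrite /inner /mid;
  case: (l =P 0) => ?; case: (r =P n.+1) => ? /=; lia.
- have ltxn : x.+1 < n by lia.
  exists (Ordinal ltxn).
  by rewrite (@twins_slot _ _ _ l r) // inn rl k0; lia.
have ltxn : x.-1 < n by lia.
exists (Ordinal ltxn).
by rewrite twinsC (@twins_slot _ _ _ l r) /= ?inn ?rl ?k0; lia.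
Qed.

Definition twinned n (O : {set 'I_n}) x := [exists y, twins O (maxdist O) x y].

Lemma maxdist_gt0 n (O : {set 'I_n}) (x : 'I_n) :
  O != set0 -> x \notin O -> 0 < maxdist O.
Proof.
move=> O0 xO; have [l [r [slr ltx]]] := slot_of xO.
apply: leq_trans (reach_le_maxdist O0 slr).
by rewrite /reach; case: ifP; lia.
Qed.

Lemma dist_gt0 n (O : {set 'I_n}) (x : 'I_n) :
  O != set0 -> x \notin O -> 0 < dist O x.
Proof.
move=> O0 xO; have [l [r [slr ltx]]] := slot_of xO.
by rewrite (dist_slot O0 slr ltx) /slot_dist;
  case: (l =P 0) => ?; case: (r =P n.+1) => ? /=; lia.
Qed.

Lemma farthest_sub n (O : {set 'I_n}) : farthest O \subset ~: O.
Proof. by apply/subsetP => x; rewrite inE => /andP[]. Qed.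

Lemma end_place_slot n (O : {set 'I_n}) (x : 'I_n) l r :
    O != set0 -> slot (bound O) l r -> l < x.+1 < r -> mid n l r x.+1 ->
  end_place x = ~~ inner n l r.
Proof.
move=> O0 slr ltx; have [ltlr lern nlr] := slot_bounds O0 slr.
have := ltn_ord x; rewrite /end_place /inner /mid.
by case: (l =P 0) => ?; case: (r =P n.+1) => ? /=; lia.
Qed.

(** * Farthest places: their number and the effect of taking one *)

Section Maximal.

Variables (n : nat) (O : {set 'I_n}).
Hypothesis O0 : O != set0.
Let k := maxdist O.

Lemma farthest_twins x : x \in farthest O ->
  [exists y in farthest O, neighbours x y] = twinned O x.
Proof.
rewrite inE => /andP[]; rewrite in_setC => xO /eqP dx.
apply/existsP/existsP => -[y]; rewrite /twins ?inE.
  by move=> /andP[/andP[yO dy] nxy]; exists y; rewrite xO yO nxy dx eqxx dy.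
by move=> /and5P[_ yO nxy _ dy]; exists y; rewrite !inE yO dy nxy.
Qed.

Lemma twins_farthest x y : twins O k x y -> x \in farthest O.
Proof. by move=> /and5P[xO _ _ dx _]; rewrite !inE xO dx. Qed.

(** Every slot of width [2k+1] contributes its two middles, hence the factor 2. *)
Lemma card_twinned : 0 < k ->
  #|[set x in farthest O | twinned O x]| = 2 * pairs k O.
Proof.
move=> k0; apply: slot_sum_card.
  by apply: subset_trans (farthest_sub O); apply/subsetP => x /setIdP[].
move=> l r slr; have [ltlr lern nlr] := slot_bounds O0 slr.
have le_k := reach_le_maxdist O0 slr.
rewrite pair_weight //.
have [/andP[inn /eqP rl]|/negbTE nd] := boolP (inner n l r && (r - l == k.*2.+1)).
  apply: (@card_place2 _ _ (l + k)).
    by move: inn; rewrite /inner; lia.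
  move=> x; rewrite inE; have [ltx|] := boolP (l < x.+1 < r); last by lia.
  rewrite (farthest_slot O0 slr ltx) /twinned (twinsP _ O0 slr ltx) inn rl.
  rewrite -/k k0 eqxx andbT /reach /mid; move: inn; rewrite /inner.
  by case: (l =P 0) => ?; case: (r =P n.+1) => ? /=; lia.
rewrite muln0; apply/eqP; rewrite cards_eq0 -subset0; apply/subsetP => x.
rewrite !inE => /andP[/andP[_ tw] ltx]; move: tw.
by rewrite /twinned (twinsP _ O0 slr ltx) andbA nd.
Qed.

(** Without pairs, each slot of full reach has one farthest place, and this is a single unless it is
    the end place of an end slot of width 2, which the last hypothesis rules out. *)
Lemma card_farthest : 0 < k -> pairs k O = 0 -> (k == 1) ==> (near_ends O == 0) ->
  #|farthest O| = singles k O.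
Proof.
move=> k0 p0 e0; rewrite -[RHS]mul1n; apply: slot_sum_card.
  exact: farthest_sub.
move=> l r slr; have [ltlr lern nlr] := slot_bounds O0 slr.
have le_k := reach_le_maxdist O0 slr.
have w0 := slot_sum_eq0 p0 slr; rewrite pair_weight // in w0.
have e1 : k = 1 -> ~~ inner n l r && (r - l == 2) = false.
  move=> k1; move: e0; rewrite k1 eqxx /= => /eqP e0.
  by have := slot_sum_eq0 e0 slr; rewrite near_end_weight; case: (_ && _).
rewrite mul1n single_weight //; last by case: (_ && _) w0.
have SE x : (x \in farthest O) && (l < x.+1 < r) =
            [&& l < x.+1 < r, mid n l r x.+1 & reach n l r == k].
  have [ltx|] := boolP (l < x.+1 < r); last by rewrite andbF.
  by rewrite (farthest_slot O0 slr ltx) /= !andbT.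
have S0 : reach n l r == k = false ->
    #|[set x in farthest O | l < x.+1 < r]| = 0.
  move=> nk; apply/eqP; rewrite cards_eq0 -subset0; apply/subsetP => x.
  by rewrite inE SE nk !andbF.
case: ifP => inn; rewrite inn /= in w0 e1.
  case: eqP => rl; last first.
    by apply: S0; move: inn w0; rewrite /inner /reach; case: ifP; lia.
  apply: (@card_place1 _ _ (l + k)); first by move: inn; rewrite /inner; lia.
  move=> x; rewrite SE /reach /mid rl; move: inn; rewrite /inner.
  by case: (l =P 0) => ?; case: (r =P n.+1) => ? /=; lia.
case: andP => [[/eqP rl k1]|]; last first.
  move=> nrl; apply: S0; move: inn; rewrite /inner /reach => /negbFE->.
  apply/eqP => rk; apply: nrl; split; first by lia.
  by apply/eqP => k1; have := e1 k1; lia.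
(* The end place of the slot, in shifted numbering. *)
apply: (@card_place1 _ _ (if l == 0 then 1 else n)); first by case: ifP; lia.
move=> x; have := ltn_ord x; rewrite SE /reach /mid rl; move: inn; rewrite /inner.
by case: (l =P 0) => ?; case: (r =P n.+1) => ? /=; lia.
Qed.

(** At maximal distance 1, an end slot that contains a place has width 2, and that place is the end
    place. *)
Lemma card_ends : k = 1 -> #|[set x in ~: O | end_place x]| = near_ends O.
Proof.
move=> k1; rewrite -[RHS]mul1n; apply: slot_sum_card.
  by apply/subsetP => x /setIdP[].
move=> l r slr; have [ltlr lern nlr] := slot_bounds O0 slr.
have := reach_le_maxdist O0 slr; rewrite -/k k1 => le_k.
have SE x : (x \in [set x in ~: O | end_place x]) && (l < x.+1 < r) =
            (l < x.+1 < r) && end_place x.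
  have [ltx|] := boolP (l < x.+1 < r); last by rewrite andbF.
  by rewrite !inE (slot_notin slr ltx) andbT.
rewrite mul1n near_end_weight; case: andP => [[inn /eqP rl]|nrl].
  apply: (@card_place1 _ _ (if l == 0 then 1 else n)).
    by case: ifP; lia.
  move=> x; have := ltn_ord x; rewrite SE /end_place; move: inn; rewrite /inner.
  by case: (l =P 0) => ?; case: (r =P n.+1) => ? /=; lia.
apply/eqP; rewrite cards_eq0 -subset0; apply/subsetP => x.
have := ltn_ord x.
rewrite inE SE /end_place => ltxn /andP[ltx ex]; case: nrl; move: le_k.
by rewrite /inner /reach; case: ifP => /= ?; lia.
Qed.

Variable x : 'I_n.
Hypothesis xF : x \in farthest O.

Lemma farthest_slotE : exists l r,
  [/\ slot (bound O) l r, l < x.+1 < r, mid n l r x.+1 & reach n l r = k].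
Proof.
have := xF; rewrite inE => /andP[]; rewrite in_setC => xO _.
have [l [r [slr ltx]]] := slot_of xO; exists l, r.
by move: xF; rewrite (farthest_slot O0 slr ltx) => /andP[? /eqP].
Qed.

(** The change is the cost of the slot that is split, whose reach is [k]. Together with the next two
    lemmas: since a twinned place is never an end place, exactly one count drops, and it drops by
    one. *)
Lemma pairs_insert j :
  pairs j O = ((j == k) && twinned O x) + pairs j (x |: O).
Proof.
have [l [r [slr ltx mx rk]]] := farthest_slotE.
rewrite /pairs (slot_sum_insert _ _ O0 slr ltx mx); congr (_ + _).
rewrite /twinned (twinsP _ O0 slr ltx) mx -/k -rk andbT.
rewrite /slot_cost /inner /reach /no_cost /pair_cost; case: ifP => _ /=; lia.
Qed.

Lemma near_ends_insert :
  near_ends O = ((k == 1) && end_place x) + near_ends (x |: O).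
Proof.
have [l [r [slr ltx mx rk]]] := farthest_slotE.
rewrite /near_ends (slot_sum_insert _ _ O0 slr ltx mx); congr (_ + _).
rewrite (end_place_slot O0 slr ltx mx) -rk.
rewrite /slot_cost /inner /reach /near_end_cost /no_cost; case: ifP => _ /=; lia.
Qed.

Lemma singles_insert j :
  singles j O =
    [&& j == k, ~~ twinned O x & ~~ ((k == 1) && end_place x)]
    + singles j (x |: O).
Proof.
have [l [r [slr ltx mx rk]]] := farthest_slotE.
rewrite /singles (slot_sum_insert _ _ O0 slr ltx mx); congr (_ + _).
rewrite (end_place_slot O0 slr ltx mx) /twinned (twinsP _ O0 slr ltx) mx -/k -rk.
rewrite /slot_cost /inner /reach /single_cost /single_end_cost.
case: ifP => _ /=; lia.
Qed.

End Maximal.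

(** * Longest runs *)

Lemma is_runP n (E R : {set 'I_n}) :
  reflect (exists a b : 'I_n, [/\ a <= b, R = [set x : 'I_n | a <= x <= b]
                                & R \subset E]) (is_run E R).
Proof.
apply: (iffP and3P) => [[R0 RE /existsP[a /existsP[b /eqP Rab]]]|].
  exists a, b; split=> //; have /set0Pn[z] := R0; rewrite Rab inE.
  by case/andP; apply: leq_trans.
move=> [a [b [ab Rab RE]]]; split=> //.
  by apply/set0Pn; exists a; rewrite Rab inE leqnn ab.
by apply/existsP; exists a; apply/existsP; exists b; apply/eqP.
Qed.

Lemma is_run1 n (E : {set 'I_n}) x : x \in E -> is_run E [set x].
Proof.
move=> xE; apply/is_runP; exists x, x; rewrite sub1set; split=> //.
by apply/setP => y; rewrite !inE -val_eqE /=; lia.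
Qed.

Lemma is_run2 n (E : {set 'I_n}) x y :
  x \in E -> y \in E -> neighbours x y -> is_run E [set x; y].
Proof.
rewrite /neighbours /gap => xE yE nxy.
wlog ltxy : x y xE yE nxy / x < y => [thm|].
  case: (ltngtP x y) => [lt|lt|eq]; last by move: nxy; lia.
    exact: thm.
  by rewrite setUC; apply: thm => //; lia.
apply/is_runP; exists x, y; split; first by lia.
  by apply/setP => z; rewrite !inE -!val_eqE /=; lia.
by apply/subsetP => z /set2P[]->.
Qed.

(** A run is an interval, so next to [x], on the side of any other element, there is one more
    element. *)
Lemma is_run_neighbour n (E R : {set 'I_n}) x :
  is_run E R -> x \in R -> 1 < #|R| -> exists2 y, y \in E & neighbours x y.
Proof.
move=> /is_runP[a [b [ab Rab RE]]] xR; rewrite (cardsD1 x) xR.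
rewrite -[1]/(1 + 0) ltn_add2l card_gt0 => /set0Pn[y].
rewrite in_setD1 -val_eqE /= => /andP[nyx yR].
have inE' z : (z \in R) = (a <= z <= b) by rewrite Rab inE.
move: xR yR; rewrite !inE' => xR yR; have ltb := ltn_ord b.
have [ltxy|ltyx] : x < y \/ y < x by lia.
  have ltz : x.+1 < n by lia.
  exists (Ordinal ltz); last by rewrite /neighbours /gap /=; lia.
  by apply: (subsetP RE); rewrite inE' /=; lia.
have ltz : x.-1 < n by lia.
exists (Ordinal ltz); last by rewrite /neighbours /gap /=; lia.
by apply: (subsetP RE); rewrite inE' /=; lia.
Qed.

Lemma card_interval n (a b : 'I_n) : #|[set x : 'I_n | a <= x <= b]| <= b.+1 - a.
Proof.
rewrite cardE -(size_map val) -(size_iota a (b.+1 - a)); apply: uniq_leq_size.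
  by rewrite (map_inj_uniq val_inj) enum_uniq.
by move=> z /mapP[y]; rewrite mem_enum mem_iota inE => yP -> /=; lia.
Qed.

(** Without three consecutive elements every run has length at most 2, so a longest run is a
    neighbouring pair as soon as one exists. *)
Lemma in_longest_run_no3 n (E : {set 'I_n}) x :
    (forall y z t : 'I_n, y \in E -> z \in E -> t \in E ->
       z = y.+1 :> nat -> t = z.+1 :> nat -> False) ->
  in_longest_run E x =
    (x \in E) && ([exists u in E, exists v in E, neighbours u v]
                   ==> [exists v in E, neighbours x v]).
Proof.
move=> no3.
have le2 R : is_run E R -> #|R| <= 2.
  move=> /is_runP[a [b [ab Rab RE]]]; case: (leqP b a.+1) => [le|lt].
    by rewrite Rab (leq_trans (card_interval a b)) //; lia.
  have ltb := ltn_ord b.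
  have lt1 : a.+1 < n by lia.
  have lt2 : a.+2 < n by lia.
  by case: (no3 a (Ordinal lt1) (Ordinal lt2)) => //;
     apply: (subsetP RE); rewrite Rab inE /=; lia.
apply/existsP/andP => [[R /and3P[runR xR /forallP maxR]]|[xE /implyP nx]].
  have [_ [_ [_ _ RE]]] := is_runP _ _ runR.
  split; first exact: (subsetP RE).
  apply/implyP => /exists_inP[u uE /exists_inP[v vE nuv]].
  have := implyP (maxR [set u; v]) (is_run2 uE vE nuv); rewrite cards2.
  have -> : u != v by apply: contraTneq nuv => ->; rewrite /neighbours /gap subnn.
  by move=> /(is_run_neighbour runR xR)[y yE nxy]; apply/exists_inP; exists y.
case: (boolP [exists v in E, neighbours x v]) => [/exists_inP[v vE nxv]|nnx].
  exists [set x; v]; rewrite is_run2 //= set21 /=.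
  apply/forallP => R; apply/implyP => /le2; rewrite cards2.
  by have -> : x != v by apply: contraTneq nxv => ->; rewrite /neighbours /gap subnn.
exists [set x]; rewrite is_run1 //= set11 /=.
apply/forallP => R; apply/implyP => runR; rewrite cards1 leqNgt.
apply/negP => lt1; have /set0Pn[u uR] : R != set0 by case/and3P: runR.
have [y yE nuy] := is_run_neighbour runR uR lt1.
have [_ [_ [_ _ RE]]] := is_runP _ _ runR.
case/negP: nnx; apply: nx; apply/exists_inP; exists u; first exact: (subsetP RE).
by apply/exists_inP; exists y.
Qed.

(** * The legal choices *)

Definition legal n (O : {set 'I_n}) x := modified_polite O x && ends_first O x.

(** The three stages at a given maximal distance: pairs first, then empty ends if the distance is 1,
    then singles. *)
Definition choices n (O : {set 'I_n}) :=
  if 0 < pairs (maxdist O) O then [set x in farthest O | twinned O x]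
  else if (maxdist O == 1) && (0 < near_ends O)
  then [set x in ~: O | end_place x] else farthest O.

(** Both [y] and [z] would have to be the left one of the two middles of the same slot. *)
Lemma farthest_no3 n (O : {set 'I_n}) (y z t : 'I_n) : O != set0 ->
    y \in farthest O -> z \in farthest O -> t \in farthest O ->
  z = y.+1 :> nat -> t = z.+1 :> nat -> False.
Proof.
rewrite !inE => O0 /andP[yO dy] /andP[zO dz] /andP[tO dt] zy tz.
have [l [r [slr lty]]] := slot_of yO.
have nyz : neighbours y z by rewrite /neighbours /gap; lia.
have nzt : neighbours z t by rewrite /neighbours /gap; lia.
have ltz := slot_neighbour slr lty zO nyz.
have := twins_slot (maxdist O) O0 slr lty zy.
have := twins_slot (maxdist O) O0 slr ltz tz.
rewrite /twins yO zO tO nyz nzt dy dz dt /=; lia.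
Qed.

Lemma twinned_inner n (O : {set 'I_n}) x :
  O != set0 -> x \in farthest O -> twinned O x -> ~~ end_place x.
Proof.
move=> O0 xF; have [l [r [slr ltx mx rk]]] := farthest_slotE O0 xF.
rewrite (end_place_slot O0 slr ltx mx) negbK /twinned (twinsP _ O0 slr ltx).
by case/and4P.
Qed.

Section Choices.

Variables (n : nat) (O : {set 'I_n}).
Hypotheses (O0 : O != set0) (OT : O != setT).
Let k := maxdist O.

Lemma empty_place : exists x, x \notin O.
Proof.
have : ~: O != set0 by apply: contraNneq OT =>
  /(congr1 (@setC _)); rewrite setCK setC0 => ->.
by case/set0Pn => x; rewrite inE; exists x.
Qed.

Lemma maxdist_pos : 0 < k.
Proof. by have [x xO] := empty_place; apply: maxdist_gt0 xO. Qed.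

Lemma pairs_gt0 : (0 < pairs k O) = [exists x, [exists y, twins O k x y]].
Proof.
have := card_twinned O0 maxdist_pos; rewrite -/k => cE.
apply/idP/existsP => [p0|[x tx]].
  have : 0 < #|[set x in farthest O | twinned O x]| by rewrite cE; lia.
  by case/card_gt0P => x; rewrite inE => /andP[_ tx]; exists x.
have : 0 < #|[set x in farthest O | twinned O x]|; last by rewrite cE; lia.
apply/card_gt0P; exists x; rewrite inE; apply/andP; split=> //.
by have /existsP[y /twins_farthest] := tx.
Qed.

Lemma pair_farthest :
  [exists u in farthest O, exists v in farthest O, neighbours u v]
  = (0 < pairs k O).
Proof.
rewrite pairs_gt0; apply/exists_inP/existsP => [[u uF uv]|[u tu]]; exists u.
- by rewrite -[[exists y, _]]/(twinned O u) -farthest_twins.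
- by have /existsP[y /twins_farthest] := tu.
- by rewrite farthest_twins //; have /existsP[y /twins_farthest] := tu.
Qed.

Lemma only_singlesE : only_singles O = (k == 1) && (pairs k O == 0).
Proof.
rewrite /only_singles -/k; case: eqP => //= k1.
by rewrite eqn0Ngt pairs_gt0 k1.
Qed.

Lemma farthest_dist1 : k = 1 -> farthest O = ~: O.
Proof.
move=> k1; apply/setP => x; rewrite !inE -/k k1.
case xO: (x \in O) => //=; apply/eqP.
have := dist_gt0 O0 (negbT xO); have := dist_le_maxdist (negbT xO).
by rewrite -/k; lia.
Qed.

(** The rule on runs selects the twinned places while pairs remain. The rule on ends acts only at
    maximal distance 1 without pairs, and then every empty place is farthest. *)
Lemma legalE x : legal O x = (x \in choices O).
Proof.
have no3 y z t := @farthest_no3 n O y z t O0.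
rewrite /legal /modified_polite /polite O0 /= in_longest_run_no3 //.
have -> b : (x \notin O) && (x \in farthest O) && ((x \in farthest O) && b) =
            (x \in farthest O) && b.
  by rewrite inE in_setC; case: (x \in O) => //=; case: eqP.
rewrite pair_farthest /ends_first only_singlesE O0 /= /choices -/k.
case: ltnP => [p0|]; last rewrite leqn0 => /eqP p0.
  rewrite (gtn_eqF p0) andbF /= andbT [in RHS]in_set.
    by case xF: (x \in farthest O) => //=; rewrite farthest_twins.
rewrite p0 eqxx /= andbT andbT; case: eqP => [k1|_] /=; last by rewrite andbT.
have -> : [exists e in ~: O, end_place e] = (0 < near_ends O).
  rewrite -(card_ends O0 k1); apply/exists_inP/card_gt0P => [[e eO ee]|[e]].
    by exists e; rewrite inE eO.
  by rewrite inE => /andP[eO ee]; exists e.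
by case: ltnP; rewrite farthest_dist1 ?inE //= ?andbT.
Qed.

Lemma card_choices_gt0 : 0 < #|choices O|.
Proof.
have k0 := maxdist_pos; rewrite /choices -/k.
case: ifP => [p0|_]; first by rewrite card_twinned // muln_gt0.
case: ifP => [/andP[/eqP k1 e0]|_]; first by rewrite card_ends.
have [x0 x0O] := empty_place.
have cO : 0 < #|~: O| by apply/card_gt0P; exists x0; rewrite inE.
have [x xO maxx] := eq_bigmax_cond (dist O) cO.
by apply/card_gt0P; exists x; rewrite inE xO /maxdist maxx /=.
Qed.

End Choices.

(** * The product formula and its recursion *)

Definition completions n (O : {set 'I_n}) :=
  (near_ends O)`! *
  \prod_(1 <= j < n) (2 ^ pairs j O * (pairs j O)`! * (singles j O)`!).

Lemma prod_nat_update n c k (f g : nat -> nat) : 0 < k < n ->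
    f k = c * g k -> (forall j, j != k -> f j = g j) ->
  \prod_(1 <= j < n) f j = c * \prod_(1 <= j < n) g j.
Proof.
move=> kn fk fg.
rewrite [LHS](bigD1_seq k) ?mem_index_iota ?iota_uniq //=.
rewrite [in RHS](bigD1_seq k) ?mem_index_iota ?iota_uniq //= fk mulnA.
by congr (_ * _); apply: eq_bigr => j; apply: fg.
Qed.

Lemma maxdist_lt n (O : {set 'I_n}) x :
  O != set0 -> x \in farthest O -> maxdist O < n.
Proof.
move=> O0 xF; have [l [r [slr ltx mx <-]]] := farthest_slotE O0 xF.
have [? ? ?] := slot_bounds O0 slr.
by rewrite /reach; case: ifP; lia.
Qed.

(** In each stage the number of choices is the factor that the product loses: [2 * pairs] from the
    power and its factorial, [near_ends] or [singles] from their own factorials. *)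
Lemma completions_choice n (O : {set 'I_n}) x : O != set0 -> O != setT ->
  x \in choices O -> completions O = #|choices O| * completions (x |: O).
Proof.
move=> O0 OT; have k0 := maxdist_pos O0 OT.
rewrite /choices; case: ltnP => [p0|]; last rewrite leqn0 => /eqP p0.
  rewrite inE => /andP[xF tx]; rewrite card_twinned // /completions.
  have nex := twinned_inner O0 xF tx.
  rewrite (near_ends_insert O0 xF) (negbTE nex) andbF add0n mulnCA.
  congr (_ * _); apply: (@prod_nat_update _ _ (maxdist O)).
  - by rewrite k0 (maxdist_lt O0 xF).
  - have sE := singles_insert O0 xF (maxdist O); rewrite tx /= andbF in sE.
    rewrite sE (pairs_insert O0 xF) eqxx tx /= !add1n expnS factS.
    by rewrite -!mulnA; congr (_ * _); rewrite mulnCA.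
  move=> j /negbTE jk.
  by rewrite (pairs_insert O0 xF) (singles_insert O0 xF) jk.
case: ifP => [/andP[/eqP k1 e0]|ke].
  move=> xC; have xF : x \in farthest O.
    by rewrite farthest_dist1 //; move: xC; rewrite inE => /andP[].
  have ex : end_place x by move: xC; rewrite inE => /andP[].
  rewrite card_ends // /completions (near_ends_insert O0 xF) k1 ex /= add1n factS.
  rewrite -mulnA; congr (_ * (_ * _)); apply: eq_bigr => j _.
  have ntx : twinned O x = false by apply/negbTE;
    apply: contraTN ex; apply: twinned_inner.
  by rewrite (pairs_insert O0 xF) (singles_insert O0 xF) k1 ex ntx !andbF.
move=> xF; rewrite card_farthest //; last first.
  by move: ke; case: eqP => //= _ /negbT; rewrite -eqn0Ngt.
(* A twinned [x], or an end place at distance 1, would make positive a count that is 0 in this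
   stage. *)
have ntx : twinned O x = false.
  apply/negbTE/negP => tx; have := pairs_insert O0 xF (maxdist O).
  by rewrite eqxx tx p0.
have nex : (maxdist O == 1) && end_place x = false.
  apply/negbTE/negP => ex; have := near_ends_insert O0 xF; rewrite ex.
  by move: ke ex; case: eqP => //= _; lia.
rewrite /completions (near_ends_insert O0 xF) nex add0n mulnCA.
congr (_ * _); apply: (@prod_nat_update _ _ (maxdist O)).
- by rewrite k0 (maxdist_lt O0 xF).
- have sE := singles_insert O0 xF (maxdist O); rewrite eqxx ntx nex /= in sE.
  rewrite sE (pairs_insert O0 xF) eqxx ntx /= add0n add1n factS.
  by rewrite mulnCA.
move=> j /negbTE jk.
by rewrite (pairs_insert O0 xF) (singles_insert O0 xF) jk.
Qed.

Lemma slot_sum_setT n ci ce : slot_sum ci ce [set: 'I_n] = 0.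
Proof.
apply: big1 => -[l r] /= slr; have /slotP[_ /bound_le ler ltlr _] := slr.
rewrite /slot_weight; case: (leqP (r - l) 1) => [le1|lt1].
  by rewrite halving_le1 // if_same.
have ltn : l < n by lia.
have ltn1 : l < (Ordinal ltn).+1 < r by rewrite /=; lia.
by have := slot_notin slr ltn1; rewrite inE.
Qed.

(** * Counting fillings step by step *)

Fixpoint nb_fillings n (rule : {set 'I_n} -> 'I_n -> bool) m (O : {set 'I_n}) :=
  if m is m'.+1 then \sum_(x | rule O x) nb_fillings rule m' (x |: O) else 1.

Lemma nb_fillings_legal n (O : {set 'I_n}) m :
  O != set0 -> #|O| + m = n -> nb_fillings (@legal n) m O = completions O.
Proof.
elim: m O => [|m IHm] O O0 cO /=.
  have -> : O = setT by apply/eqP; rewrite eqEcard subsetT cardsT card_ord; lia.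
  rewrite /completions /near_ends slot_sum_setT mul1n big1 // => j _.
  by rewrite /pairs /singles !slot_sum_setT.
have OT : O != setT.
  by apply/negP => /eqP OT; move: cO; rewrite OT cardsT card_ord; lia.
rewrite (eq_bigl (mem (choices O))); last by move=> x; apply: legalE.
(* After multiplication by the number of choices both sides are sums over the choices, and they
   agree term by term. *)
apply/eqP; rewrite -(eqn_pmul2l (card_choices_gt0 O0 OT)); apply/eqP.
rewrite big_distrr /= -sum_nat_const; apply: eq_bigr => x xC.
have xO : x \notin O.
  by move: xC; rewrite -legalE // => /andP[/andP[/andP[]]].
rewrite IHm ?(completions_choice O0 OT xC) //.
  by apply/set0Pn; exists x; rewrite setU11.
by rewrite cardsU1 xO; lia.
Qed.

(** Variant of [obeys] for a sequence that starts from an arbitrary occupied set, suited to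
    induction on the sequence. *)
Fixpoint follows n (rule : {set 'I_n} -> 'I_n -> bool) (O : {set 'I_n}) s :=
  if s is x :: s' then rule O x && follows rule (x |: O) s' else true.

Lemma followsP n (rule : {set 'I_n} -> 'I_n -> bool) (O : {set 'I_n}) s x0 :
  reflect (forall t, t < size s -> rule (O :|: [set x in take t s]) (nth x0 s t))
          (follows rule O s).
Proof.
elim: s O => [|x s IHs] O /=; first by apply: ReflectT.
have set_nil : [set y in [::]] = set0 :> {set 'I_n} by apply/setP => y; rewrite !inE.
have stepE t : O :|: [set y in x :: take t s] = (x |: O) :|: [set y in take t s].
  by apply/setP => y; rewrite !inE orbCA orbA.
apply: (iffP andP) => [[rx /IHs rs] [_|t lt]|rP] /=.
- by rewrite set_nil setU0.
- by rewrite stepE; apply: rs.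
split; first by have := rP 0 isT; rewrite /= set_nil setU0.
by apply/IHs => t lt; rewrite -stepE; apply: (rP t.+1).
Qed.

Lemma obeysE n (rule : {set 'I_n} -> 'I_n -> bool) (s : n.-tuple 'I_n) :
  obeys rule s = follows rule set0 s.
Proof.
case: (posnP n) s => [n0|n0] s.
  rewrite [tval s]size0nil ?size_tuple //=; apply/forallP => t.
  suff : 0 < n by rewrite {1}n0.
  exact: leq_ltn_trans (ltn_ord t).
apply/forallP/(followsP _ _ _ (Ordinal n0)) => [rs t|rs t].
  rewrite size_tuple => ltn; have := rs (Ordinal ltn).
  by rewrite (tnth_nth (Ordinal n0)) /occupied set0U.
have := rs t; rewrite size_tuple ltn_ord => /(_ isT).
by rewrite (tnth_nth (Ordinal n0)) /occupied set0U.
Qed.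

(** A tuple is split into its head, the next person's place, and its tail. *)
Lemma card_follows n (rule : {set 'I_n} -> 'I_n -> bool) m (O : {set 'I_n}) :
  #|[set s : m.-tuple 'I_n | follows rule O s]| = nb_fillings rule m O.
Proof.
elim: m O => [|m IHm] O /=.
  rewrite (_ : [set s | _] = setT) ?cardsT ?card_tuple //.
  by apply/setP => s; rewrite !inE (tuple0 s).
rewrite -sum1dep_card (reindex (fun p : 'I_n * m.-tuple 'I_n => cons_tuple p.1 p.2)) /=;
  last first.
  exists (fun s : m.+1.-tuple 'I_n => (thead s, behead_tuple s)) => [[x s] _|s _] /=.
    by congr (_, _); apply: val_inj.
  by rewrite [RHS]tuple_eta.
rewrite -(pair_big_dep (fun x => rule O x)
  (fun x (s : m.-tuple 'I_n) => follows rule (x |: O) s) (fun _ _ => 1)) /=.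
by apply: eq_bigr => x _; rewrite -IHm -sum1dep_card.
Qed.

(** * The state after the first person *)

Definition end_weight (ci ce : nat -> nat) w :=
  if w <= 1 then 0 else ce w + halving ci w.-1.

Lemma slot_set0 n a b :
  slot (bound (set0 : {set 'I_n})) a b = (a == 0) && (b == n.+1).
Proof.
have b0 z : bound (set0 : {set 'I_n}) z = (z == 0) || (z == n.+1).
  rewrite /bound; case: existsP => [[y]|_]; first by rewrite inE.
  by rewrite orbF.
apply/slotP/andP => [[]|[/eqP-> /eqP->]]; first by rewrite !b0; lia.
by rewrite !b0 !eqxx orbT; split=> // z zP; rewrite b0; lia.
Qed.

(** The whole row is a single slot of the empty set, and [x] splits it into two end slots. *)
Lemma slot_sum1 n ci ce (x : 'I_n) :
  slot_sum ci ce [set x] = end_weight ci ce x.+1 + end_weight ci ce (n - x).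
Proof.
have ltxn := ltn_ord x.
have sl0 : slot (bound (set0 : {set 'I_n})) 0 n.+1 by rewrite slot_set0 !eqxx.
have ltx : 0 < x.+1 < n.+1 by lia.
have ins a b := slot_insert a b sl0 ltx (bound_insert set0 x).
have ltz : x.+1 < n.+2 by lia.
rewrite -[[set x]]setU0 /slot_sum.
rewrite (bigD1 (ord0, Ordinal ltz)) /=; last by rewrite ins !eqxx.
rewrite (bigD1 (Ordinal ltz, ord_max)) /=; last first.
  by rewrite ins !eqxx orbT.
rewrite big_pred0; last first.
  by move=> [a b] /=; rewrite ins slot_set0 andbN orbF !xpair_eqE -!val_eqE /=; lia.
by rewrite addn0 /slot_weight /= eqxx subn0 subSS.
Qed.

(** * The numbers of persons and of pairs in a leftmost filling *)

Lemma polite_farthest n (O : {set 'I_n}) x :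
  O != set0 -> polite O x -> x \in farthest O.
Proof. by rewrite /polite => -> /andP[]. Qed.

(** Persons are counted whether they take a place of a pair or a single, so parity is ignored and an
    end slot of width 2 is included. *)
Definition dist_cost (k w : nat) : nat := w./2 == k.
Definition dist_end_cost (k w : nat) : nat := w.-1 == k.

Lemma slot_sum_dist n k (O : {set 'I_n}) x : O != set0 -> x \in farthest O ->
  slot_sum (dist_cost k) (dist_end_cost k) O =
    (dist O x == k) + slot_sum (dist_cost k) (dist_end_cost k) (x |: O).
Proof.
move=> O0 xF; have [l [r [slr ltx mx rk]]] := farthest_slotE O0 xF.
rewrite (slot_sum_insert _ _ O0 slr ltx mx); congr (_ + _).
move: xF; rewrite inE => /andP[_ /eqP ->]; rewrite -rk.
by rewrite /slot_cost /reach /dist_cost /dist_end_cost; case: ifP.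
Qed.

(** The slot sum drops by one with each person who sits at distance [k], and it is 0 when the row is
    full. *)
Lemma sum_dist_filling n k (O : {set 'I_n}) s x0 : O != set0 ->
    follows (@polite n) O s -> O :|: [set y in s] = setT ->
  \sum_(t < size s) (dist (O :|: [set y in take t s]) (nth x0 s t) == k) =
  slot_sum (dist_cost k) (dist_end_cost k) O.
Proof.
elim: s O => [|x s IHs] O O0 /=.
  move=> _; rewrite (_ : [set y in [::]] = set0) ?setU0 => [->|].
    by rewrite big_ord0 slot_sum_setT.
  by apply/setP => y; rewrite !inE.
move=> /andP[/(polite_farthest O0) xF fs] OT.
rewrite big_ord_recl /= (slot_sum_dist _ O0 xF) -IHs //; last first.
- by rewrite -OT; apply/setP => y; rewrite !inE orbCA orbA.
- by apply/set0Pn; exists x; rewrite setU11.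
congr (_ + _).
  by rewrite (_ : [set y in [::]] = set0) ?setU0 //; apply/setP => y; rewrite !inE.
apply: eq_bigr => t _; rewrite /=.
by congr (dist _ _ == k : nat); apply/setP => y; rewrite !inE orbCA orbA.
Qed.

Definition twin_sets n k (O : {set 'I_n}) : {set {set 'I_n}} :=
  [set P : {set 'I_n} | [exists x, exists y, (P == [set x; y]) && twins O k x y]].

Lemma twin_setsP n k (O : {set 'I_n}) (P : {set 'I_n}) :
  reflect (exists x y : 'I_n,
             [/\ P = [set x; y], twins O k x y & y = x.+1 :> nat])
          (P \in twin_sets k O).
Proof.
rewrite inE; apply: (iffP existsP) => [[x /existsP[y /andP[/eqP PE tw]]]|].
  have [yx|xy] : y = x.+1 :> nat \/ x = y.+1 :> nat.
    by case/and5P: tw => _ _; rewrite /neighbours /gap; lia.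
  - by exists x, y.
  by exists y, x; rewrite twinsC setUC.
by move=> [x [y [-> tw _]]]; exists x; apply/existsP; exists y; rewrite eqxx.
Qed.

(* A pair never changes its distance until one of its places is taken, so the
   pairs ever seen are counted by the persons who take a place of a pair. *)
Lemma twin_sets_keep n k (O : {set 'I_n}) x P : O != set0 ->
  x \in farthest O -> P \in twin_sets k O -> x \notin P ->
  P \in twin_sets k (x |: O).
Proof.
move=> O0 xF /twin_setsP[y [z [-> tw zy]]] xyz.
apply/twin_setsP; exists y, z; split=> //.
have /and5P[yO zO nyz _ _] := tw.
have [l [r [slr lty]]] := slot_of yO.
have ltz := slot_neighbour slr lty zO nyz.
move: tw; rewrite (twins_slot k O0 slr lty zy) => tw.
have nltx : ~~ (l < x.+1 < r).
  apply/negP => ltx; move: xF; rewrite (farthest_slot O0 slr ltx) => /andP[mx _].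
  move: xyz; rewrite !inE -!val_eqE /=; move: tw mx; rewrite /inner /mid.
  by case: (l =P 0) => ?; case: (r =P n.+1) => ? /=; lia.
have xO0 : x |: O != set0 by apply/set0Pn; exists x; rewrite setU11.
have slr' : slot (bound (x |: O)) l r.
  have /slotP[bl br ltlr nb] := slr.
  apply/slotP; rewrite !bound_insert bl br !orbT; split=> // t ltt.
  by rewrite bound_insert negb_or nb // andbT; apply: contraNneq nltx => <-.
by rewrite (twins_slot k xO0 slr' lty zy).
Qed.

(** As [x] is farthest, a pair through it has the maximal distance, and two such pairs would give
    three consecutive farthest places. *)
Lemma card_twin_sets_hit n k (O : {set 'I_n}) x : O != set0 ->
    x \in farthest O ->
  #|[set P in twin_sets k O | x \in P]| = ((k == maxdist O) && twinned O x).
Proof.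
move=> O0 xF.
have twx P : P \in twin_sets k O -> x \in P ->
    exists y, [/\ P = [set x; y], twins O k x y & k = maxdist O].
  have kE a : twins O k x a -> k = maxdist O.
    case/and5P=> _ _ _ /eqP <- _; move: xF; rewrite inE => /andP[_ /eqP //].
  move=> /twin_setsP[a [b [-> tw ba]]] /set2P[xa|xb].
    by exists b; rewrite xa; split=> //; apply: (kE b); rewrite xa.
  by exists a; rewrite setUC xb twinsC; split=> //; apply: (kE a); rewrite xb twinsC.
case: andP => [[/eqP kE /existsP[y tw]]|ntw]; last first.
  apply/eqP; rewrite cards_eq0 -subset0; apply/subsetP => P.
  rewrite inE => /andP[Ptw xP]; have [y [_ tw kE]] := twx P Ptw xP.
  by case: ntw; rewrite kE eqxx; split=> //; apply/existsP; exists y; rewrite -kE.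
rewrite -kE in tw; rewrite (_ : [set P in _ | _] = [set [set x; y]]) ?cards1 //.
apply/setP => P; rewrite in_set in_set1; apply/andP/eqP => [[Ptw xP]|->].
  have [z [-> twz _]] := twx P Ptw xP; congr [set _; _].
  have zF : z \in farthest O by apply: (@twins_farthest _ _ z x); rewrite -kE twinsC.
  have yF : y \in farthest O by apply: (@twins_farthest _ _ y x); rewrite -kE twinsC.
  move: tw twz => /and5P[_ _ nxy _ _] /and5P[_ _ nxz _ _].
  apply/eqP; rewrite -val_eqE; apply/eqP => /=.
  have no1 := farthest_no3 O0 yF xF zF; have no2 := farthest_no3 O0 zF xF yF.
  by move: nxy nxz; rewrite /neighbours /gap; lia.
split; last by rewrite set21.
by rewrite inE; apply/existsP; exists x; apply/existsP; exists y; rewrite eqxx.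
Qed.

Lemma twin_sets_setT n k : twin_sets k [set: 'I_n] = set0.
Proof.
apply/setP => P; rewrite [RHS]inE; apply/negP => /twin_setsP[x [y [_]]].
by rewrite /twins inE.
Qed.

Fixpoint seen_twins n k (O : {set 'I_n}) s : {set {set 'I_n}} :=
  if s is x :: s' then twin_sets k O :|: seen_twins k (x |: O) s'
  else twin_sets k O.

Lemma seen_twins_sub n k (O : {set 'I_n}) s : twin_sets k O \subset seen_twins k O s.
Proof. by case: s => [|x s] //=; apply: subsetUl. Qed.

Lemma seen_twinsP n k (O : {set 'I_n}) s P :
  reflect (exists2 t, t <= size s
                    & P \in twin_sets k (O :|: [set y in take t s]))
          (P \in seen_twins k O s).
Proof.
have set_nil : [set y in [::]] = set0 :> {set 'I_n} by apply/setP => y; rewrite !inE.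
elim: s O => [|x s IHs] O /=.
  apply: (iffP idP) => [PO|[t _]]; last by rewrite set_nil setU0.
  by exists 0; rewrite // set_nil setU0.
have stepE t : O :|: [set y in x :: take t s] = (x |: O) :|: [set y in take t s].
  by apply/setP => y; rewrite !inE orbCA orbA.
apply: (iffP setUP) => [[PO|/IHs[t let_s Pt]]|[[|t] let_s /=]].
- by exists 0; rewrite // set_nil setU0.
- by exists t.+1; rewrite //= stepE.
- by rewrite set_nil setU0; left.
by rewrite stepE => Pt; right; apply/IHs; exists t.
Qed.

Lemma seen_twins_empty n k (O : {set 'I_n}) s x P :
  x \in O -> P \in seen_twins k O s -> x \notin P.
Proof.
move=> xO /seen_twinsP[t _ /twin_setsP[y [z [-> /and5P[yO zO _ _ _] _]]]].
by apply/negP => /set2P[xE|xE]; move: yO zO; rewrite -xE !inE xO.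
Qed.

(** A pair visible now either contains [x], and then is never seen again, or is still visible after
    [x] is taken. So each step adds just the pairs hit by [x]. *)
Lemma card_seen_twins n k (O : {set 'I_n}) s : O != set0 ->
    follows (@polite n) O s -> O :|: [set y in s] = setT ->
  #|seen_twins k O s| = pairs k O.
Proof.
elim: s O => [|x s IHs] O O0 /=.
  move=> _; rewrite (_ : [set y in [::]] = set0) ?setU0 => [->|].
    by rewrite twin_sets_setT cards0 /pairs slot_sum_setT.
  by apply/setP => y; rewrite !inE.
move=> /andP[/(polite_farthest O0) xF fs] OT.
have xO0 : x |: O != set0 by apply/set0Pn; exists x; rewrite setU11.
rewrite (pairs_insert O0 xF) -card_twin_sets_hit // -IHs //; last first.
  by rewrite -OT; apply/setP => y; rewrite !inE orbCA orbA.
have -> : twin_sets k O :|: seen_twins k (x |: O) s =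
          [set P in twin_sets k O | x \in P] :|: seen_twins k (x |: O) s.
  apply/setP => P; rewrite !in_setU in_set.
  case PO: (P \in twin_sets k O) => //=; case xP: (x \in P) => //=.
  by rewrite (subsetP (seen_twins_sub k (x |: O) s)) // twin_sets_keep // xP.
rewrite cardsU (_ : _ :&: _ = set0) ?cards0 ?subn0 //.
apply/setP => P; rewrite in_setI !in_set; case xP: (x \in P); last by rewrite andbF.
rewrite andbT; apply/negP => /andP[_ /seen_twins_empty].
by move=> /(_ x (setU11 _ _)); rewrite xP.
Qed.

Section Leftmost.

Variables (n : nat) (s : n.-tuple 'I_n).
Hypotheses (n0 : 0 < n) (sL : leftmost_filling s).

Lemma leftmost_cons : exists x s', [/\ s = x :: s' :> seq 'I_n, x = 0 :> nat,
  follows (@polite n) [set x] s' & [set x] :|: [set y in s'] = setT].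
Proof.
have /andP[ob /forallP s0] := sL.
case sE: (tval s) => [|x s']; first by have := size_tuple s; rewrite sE /=; lia.
have x0 : x = 0 :> nat.
  have := s0 (Ordinal n0); rewrite (tnth_nth x) sE /= => /eqP //.
exists x, s'; split=> //.
  by move: ob; rewrite obeysE sE /= setU0 => /andP[].
(* A polite person takes an empty place, so the [n] persons take distinct places and fill the
   row. *)
have us : uniq s.
  have := ob; rewrite obeysE => /(followsP _ _ _ x) => fs.
  apply/(uniqP x) => i j; rewrite !inE.
  wlog ltij : i j / i < j => [thm|].
    case: (ltngtP i j) => // lt /= li lj eq; first exact: (thm i j).
    by apply/esym; apply: (thm j i).
  move=> li lj eq; have := fs j lj; rewrite /polite => /andP[/negP[]].
  by rewrite set0U inE -eq -(nth_take x ltij) mem_nth // size_take lj.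
apply/eqP; rewrite eqEcard subsetT cardsT card_ord /=.
rewrite (_ : _ :|: _ = [set y in tval s]).
  by rewrite cardsE (card_uniqP us) size_tuple.
by rewrite sE; apply/setP => y; rewrite !inE.
Qed.

Lemma occupied_cons x s' t : s = x :: s' :> seq 'I_n ->
  occupied t.+1 s = [set x] :|: [set y in take t s'].
Proof. by move=> sE; rewrite /occupied sE; apply/setP => y; rewrite !inE. Qed.

Lemma nb_at_distE k :
  nb_at_dist s k = end_weight (dist_cost k) (dist_end_cost k) n.
Proof.
have [x [s' [sE x0 fs sT]]] := leftmost_cons.
have ss : (size s').+1 = n by have := size_tuple s; rewrite sE.
have sx0 : [set x] != set0 by apply/set0Pn; exists x; rewrite set11.
have := slot_sum1 (dist_cost k) (dist_end_cost k) x.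
rewrite x0 subn0 add0n => <-; rewrite -(sum_dist_filling k x sx0 fs sT).
rewrite /nb_at_dist -sum1dep_card big_mkcond /=.
rewrite -(big_mkord xpredT
  (fun t => (dist ([set x] :|: [set y in take t s']) (nth x s' t) == k : nat))).
rewrite (eq_bigr (fun t : 'I_n =>
   (fun t => ((0 < t) && (dist (occupied t s) (nth x s t) == k)) : nat) t));
     last first.
  by move=> t _; rewrite (tnth_nth x); case: ifP.
rewrite -(big_mkord xpredT
  (fun t => ((0 < t) && (dist (occupied t s) (nth x s t) == k)) : nat)).
(* Person 0 is not counted, and person [t.+1] of [s] is person [t] of [s']. *)
rewrite -[X in index_iota 0 X]ss big_nat_recl // add0n; apply: eq_big_nat => t _.
by rewrite (occupied_cons _ sE) sE.
Qed.

Lemma nb_pairs_at_distE k :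
  nb_pairs_at_dist s k = end_weight (pair_cost k) no_cost n.
Proof.
have [x [s' [sE x0 fs sT]]] := leftmost_cons.
have ss : (size s').+1 = n by have := size_tuple s; rewrite sE.
have sx0 : [set x] != set0 by apply/set0Pn; exists x; rewrite set11.
have := slot_sum1 (pair_cost k) no_cost x.
rewrite x0 subn0 add0n -/(pairs k [set x]) => <-.
rewrite -(card_seen_twins k sx0 fs sT); apply: eq_card => P; rewrite inE.
apply/existsP/seen_twinsP => [[y /existsP[z /and3P[PE nyz /existsP[t]]]]|].
  move=> /and5P[t0 yO zO dy dz]; exists t.-1;
    first by rewrite -ltnS prednK // ss ltnW.
  rewrite -(occupied_cons _ sE) prednK //.
  rewrite inE; apply/existsP; exists y; apply/existsP; exists z.
  by rewrite PE /twins yO zO nyz dy dz.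
move=> [t let_s /twin_setsP[y [z [PE tw _]]]].
(* At time [size s'] the row is full and shows no pair. *)
have ltt : t < size s'.
  rewrite ltn_neqAle let_s andbT; apply/eqP => tE.
  by move: tw; rewrite tE take_size sT /twins inE.
have ltn : t.+1 < n by lia.
move: tw; rewrite -(occupied_cons _ sE) => /and5P[yO zO nyz dy dz].
exists y; apply/existsP; exists z; rewrite PE eqxx nyz.
by apply/existsP; exists (Ordinal ltn); rewrite /= yO zO dy dz.
Qed.

End Leftmost.

(** * Summation over the first place *)

Lemma A095912_sum n : 0 < n ->
  A095912 n = \sum_(x < n) completions [set x].
Proof.
case: n => // n _; rewrite /A095912.
transitivity (nb_fillings (@legal n.+1) n.+1 set0).
  rewrite -card_follows; apply: eq_card => s.
  by rewrite !inE -obeysE.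
rewrite [LHS]/=; apply: eq_big => [x|x _].
  by rewrite /legal /modified_polite /polite /ends_first inE eqxx.
rewrite setU0 nb_fillings_legal ?cards1 //.
by apply/set0Pn; exists x; rewrite set11.
Qed.

(** This identifies [b - d] with the number of singles. Width 2 is excluded because its end place
    counts as a near end instead. *)
Lemma end_weight_dist k w : 2 < w ->
  end_weight (dist_cost k) (dist_end_cost k) w =
    end_weight (pair_cost k) no_cost w
    + end_weight (single_cost k) (single_end_cost k) w.
Proof.
move=> ltw; rewrite /end_weight.
rewrite (@halvingD (pair_cost k) (single_cost k) (dist_cost k)); last first.
  by move=> u; rewrite /dist_cost /pair_cost /single_cost; case: odd; rewrite ?addn0.
case: ifP => [|_]; first by lia.
have -> : dist_end_cost k w = single_end_cost k w.
  by rewrite /dist_end_cost /single_end_cost (gtn_eqF ltw) andbT.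
by rewrite /no_cost add0n addnCA.
Qed.

Lemma near_end_weightE w : end_weight no_cost near_end_cost w = (w == 2).
Proof.
rewrite /end_weight halving_eq0 // addn0 /near_end_cost.
by case: ifP => //; case: eqP => //; lia.
Qed.

Theorem mainTheorem7 (F : forall p : nat, p.-tuple 'I_p)
    (hF : forall p : nat, 0 < p -> leftmost_filling (F p))
    (n : nat) (hn : 4 <= n) :
  let b := b_of F in
  let d := d_of F in
  A095912 n =
    2 * (\sum_(n - 1 <= i < n.+1)
           \prod_(1 <= j < n)
             (2 ^ d i j * (d i j)`! * (b i j - d i j)`!)) +
    \sum_(3 <= i < n - 1)
      \prod_(1 <= j < n)
        (2 ^ (d i j + d (n + 1 - i) j)
         * (d i j + d (n + 1 - i) j)`!
         * (b i j + b (n + 1 - i) j - d i j - d (n + 1 - i) j)`!).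
Proof.
move=> b d.
pose D i j := end_weight (pair_cost j) no_cost i.
pose S i j := end_weight (single_cost j) (single_end_cost j) i.
have dE i j : 0 < i -> d i j = D i j.
  by move=> i0; apply: nb_pairs_at_distE (hF i i0) j.
have bE i j : 2 < i -> b i j = D i j + S i j.
  move=> lti; rewrite -end_weight_dist //.
  by apply: nb_at_distE; [|apply: hF]; lia.
(* The number of completions when the first person leaves end slots of widths [u] and [v]. *)
pose T u v := ((u == 2) + (v == 2))`! *
  \prod_(1 <= j < n) (2 ^ (D u j + D v j) * (D u j + D v j)`! * (S u j + S v j)`!).
have TC u v : T u v = T v u.
  rewrite /T addnC; congr (_ * _).
  by apply: eq_bigr => j _; rewrite (addnC (D u j)) (addnC (S u j)).
(* An end slot of width 1 or 2 holds no pair and no single; at most it gives one near end, whose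
   factorial is 1. *)
have T1 v u : u < 3 -> 2 < v ->
    T u v = \prod_(1 <= j < n) (2 ^ d v j * (d v j)`! * (b v j - d v j)`!).
  move=> ltu ltv; rewrite /T (gtn_eqF ltv) addn0.
  have -> : (u == 2)`! = 1 by case: eqP.
  rewrite mul1n; apply: eq_bigr => j _; rewrite dE ?bE //; last by lia.
  have -> : D u j = 0.
    by rewrite /D /end_weight; case: leqP => // ?; rewrite halving_le1 //; lia.
  have -> : S u j = 0.
    rewrite /S /end_weight; case: leqP => // ?;
      rewrite halving_le1 ?addn0 /single_end_cost; lia.
  by rewrite !add0n addKn.
have -> : A095912 n = \sum_(1 <= i < n.+1) T i (n.+1 - i).
  rewrite A095912_sum; last by lia.
  rewrite big_add1 big_mkord; apply: eq_bigr => x _.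
  rewrite /completions /near_ends slot_sum1 !near_end_weightE subSS; congr (_ * _).
  by apply: eq_bigr => j _; rewrite /pairs /singles !slot_sum1.
(* First places 1, 2, [n - 1] and [n] are split off; the symmetry [TC] matches them in twos, which
   yields the factor 2. *)
rewrite big_ltn; last by lia.
rewrite big_ltn; last by lia.
rewrite (@big_cat_nat _ _ _ (n - 1)) /=; try lia.
have sum2 (G : nat -> nat) : \sum_(n - 1 <= i < n.+1) G i = G (n - 1) + G n.
  rewrite big_ltn; last by lia.
  rewrite big_ltn; last by lia.
  rewrite big_geq ?addn0; last by lia.
  by congr (_ + G _); lia.
rewrite !sum2 -(T1 (n - 1) 2) -?(T1 n 1) //; try lia.
have -> : T (n - 1) (n.+1 - (n - 1)) = T 2 (n - 1).
  by rewrite TC; congr (T _ _); lia.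
have -> : T n (n.+1 - n) = T 1 n by rewrite TC; congr (T _ _); lia.
have -> : \sum_(3 <= i < n - 1) T i (n.+1 - i) =
    \sum_(3 <= i < n - 1) \prod_(1 <= j < n) (2 ^ (d i j + d (n + 1 - i) j)
         * (d i j + d (n + 1 - i) j)`!
         * (b i j + b (n + 1 - i) j - d i j - d (n + 1 - i) j)`!).
  apply: eq_big_nat => i lti; rewrite /T addn1.
  have -> : (i == 2) = false by lia.
  have -> : (n.+1 - i == 2) = false by lia.
  rewrite mul1n; apply: eq_bigr => j _.
  rewrite !dE ?bE; try lia.
  by congr (_ * _`!); lia.
have -> : n.+1 - 1 = n by lia.
have -> : n.+1 - 2 = n - 1 by lia.
lia.
Qed.
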